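(* Let $R$ be a finite distributive lattice and $C$ its Coxeter matrix, with rows and columns ordered with respect to a fixed linear extension of $R$. Then $C=PU$ for a permutation matrix $P$ and an upper triangular matrix $U$, and the Coxeter permutation given by $P$ is the rowmotion bijection on $R$.
   Context: For a finite poset $R$, let $\omega$ be the matrix with rows and columns indexed by $R$ whose $(x,y)$ entry is $1$ if $y\le x$ and $0$ otherwise (this is the Cartan matrix of the incidence algebra of $R$). The Coxeter matrix of $R$ is $C=-\omega^T\omega^{-1}$. A linear extension is a total ordering of the elements such that if $x<y$ in $R$ then $x$ comes before $y$. A permutation matrix $P$ is identified with the permutation sending $i$ to the index of the unique row having a non-zero entry in the $i$-th column. If $C=U_1PU_2$ with $U_1,U_2$ upper triangular and $P$ a permutation matrix, then $P$ is uniquely determined and the corresponding permutation is called the Coxeter permutation. Rowmotion: a finite distributive lattice $R$ is isomorphic to the lattice of order ideals (ordered by inclusion) of a finite poset $Q$ (its poset of join-irreducibles). Under this identification, for an order ideal $x$ of $Q$, $\operatorname{row}(x)$ is the order ideal of $Q$ generated by the minimal elements of $Q\setminus x$; this is a bijection $R\to R$. *)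

(* Defs.v *)
From HB Require Import structures.
From mathcomp Require Import all_boot all_order all_fingroup all_algebra.

Set Implicit Arguments.
Unset Strict Implicit.
Unset Printing Implicit Defensive.

Import Order.TTheory GRing.Theory.

Section Rowmotion.
Local Open Scope order_scope.

Definition order_ideal d (Q : finPOrderType d) (I : {set Q}) : bool :=
  [forall x, forall y, (x \in I) && (y <= x) ==> (y \in I)].

Definition ideal_gen d (Q : finPOrderType d) (A : {set Q}) : {set Q} :=
  [set y | [exists x, (x \in A) && (y <= x)]].

Definition minimals d (Q : finPOrderType d) (A : {set Q}) : {set Q} :=
  [set x in A | [forall y in A, ~~ (y < x)]].

Definition row_ideal d (Q : finPOrderType d) (I : {set Q}) : {set Q} :=
  ideal_gen (minimals (~: I)).

Definition join_irreducible d (R : finTBDistrLatticeType d) (x : R) : bool :=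
  (x != \bot) &&
  [forall y, forall z, (x == y `|` z) ==> (x == y) || (x == z)].

Record JI d (R : finTBDistrLatticeType d) : Type :=
  MkJI { ji_val :> R; ji_valP : join_irreducible ji_val }.

HB.instance Definition _ d (R : finTBDistrLatticeType d) :=
  [isSub of JI R for @ji_val d R].
HB.instance Definition _ d (R : finTBDistrLatticeType d) :=
  [Finite of JI R by <:].
HB.instance Definition _ d (R : finTBDistrLatticeType d) :=
  [SubChoice_isSubPOrder of JI R by <: with d].

(* The identification of R with the lattice of order ideals of JI R; that these
   two maps are mutually inverse is birkhoffK, birkhoff_invK below. *)
Definition birkhoff d (R : finTBDistrLatticeType d) (x : R) : {set JI R} :=
  [set q : JI R | val q <= x].

Definition birkhoff_inv d (R : finTBDistrLatticeType d) (I : {set JI R}) : R :=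
  \join_(q in I) val q.

Definition rowmotion d (R : finTBDistrLatticeType d) (x : R) : R :=
  birkhoff_inv (row_ideal (birkhoff x)).

Section Birkhoff.
Variables (d : Order.disp_t) (R : finTBDistrLatticeType d).
Implicit Types (x y : R) (I : {set JI R}).

Lemma birkhoff_ideal x : order_ideal (birkhoff x).
Proof.
apply/forallP => p; apply/forallP => q; apply/implyP; rewrite !inE.
by case/andP => px qp; apply: le_trans px; rewrite Order.le_val.
Qed.

Lemma birkhoff_le x y : (birkhoff x \subset birkhoff y) = (x <= y).
Proof.
apply/idP/idP; last first.
  by move=> xy; apply/subsetP => q; rewrite !inE => /le_trans; apply.
have [n] := ubnP #|[set z | z < x]|; elim: n x => // n IH x ltn sxy.
have [->|xn0] := eqVneq x \bot; first exact: le0x.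
have [jx|] := boolP (join_irreducible x).
  have /(subsetP sxy) : MkJI jx \in birkhoff x by rewrite inE /=.
  by rewrite inE.
rewrite /join_irreducible xn0 /= => /forallPn[a /forallPn[b]].
rewrite negb_imply negb_or => /andP[/eqP xab /andP[xa xb]].
have rec z : z <= x -> x != z -> z <= y.
  move=> zx nxz; have ltzx : z < x by rewrite lt_def nxz.
  apply: IH; last first.
    by apply: subset_trans sxy; apply/subsetP => q; rewrite !inE => /le_trans; apply.
  rewrite -ltnS; apply: leq_trans ltn; rewrite ltnS.
  apply: proper_card; apply/properP; split.
    by apply/subsetP => t; rewrite !inE => /lt_trans; apply.
  by exists z; rewrite !inE ?ltxx.
by rewrite xab leUx !rec // xab ?leUl ?leUr // -xab.
Qed.

Lemma birkhoff_inj : injective (@birkhoff d R).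
Proof.
by move=> x y E; apply/le_anti; rewrite -!birkhoff_le E subxx.
Qed.

Lemma join_irreducible_prime (q : R) (s : seq (JI R)) (P : pred (JI R)) :
  join_irreducible q -> q <= \join_(p <- s | P p) val p ->
  exists2 p, P p & q <= val p.
Proof.
move=> /andP[qn0 /forallP jq]; elim: s => [|p s IH].
  by rewrite big_nil lex0 (negPf qn0).
rewrite big_cons; case: ifP => // Pp.
set j := \join_(_ <- _ | _) _ => qj.
have /eqP E : q == (q `&` val p) `|` (q `&` j) by rewrite -meetUr eq_sym; apply/eqP/meet_idPl.
have := jq (q `&` val p) => /forallP/(_ (q `&` j)).
rewrite -E eqxx /= => /orP[] /eqP qE.
  by exists p => //; rewrite qE leIr.
by apply: IH; rewrite qE leIr.
Qed.

Lemma birkhoff_invK I : order_ideal I -> birkhoff (birkhoff_inv I) = I.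
Proof.
move=> /forallP idI; apply/setP => q; rewrite inE; apply/idP/idP; last first.
  by move=> qI; exact: joins_sup.
move=> /(join_irreducible_prime (valP q))[p pI qp].
by have /forallP/(_ q)/implyP := idI p; apply; rewrite pI -Order.le_val.
Qed.

Lemma birkhoffK : cancel (@birkhoff d R) (@birkhoff_inv d R).
Proof. by move=> x; apply: birkhoff_inj; rewrite birkhoff_invK ?birkhoff_ideal. Qed.

Lemma birkhoff_rowmotion x : birkhoff (rowmotion x) = row_ideal (birkhoff x).
Proof.
apply: birkhoff_invK; apply/forallP => p; apply/forallP => q; apply/implyP.
rewrite !inE => /andP[/existsP[r /andP[rm pr]] qp].
by apply/existsP; exists r; rewrite rm (le_trans qp).
Qed.

End Birkhoff.
End Rowmotion.

Section Coxeter.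
Local Open Scope ring_scope.

Definition linear_extension d (R : finPOrderType d) n (e : 'I_n -> R) : Prop :=
  bijective e /\ forall i j : 'I_n, (e i < e j)%O -> (i < j)%N.

Definition cartan_mx (K : comUnitRingType) d (R : finPOrderType d) n
    (e : 'I_n -> R) : 'M[K]_n :=
  \matrix_(i, j) (e j <= e i)%O%:R.

Definition coxeter_mx (K : comUnitRingType) d (R : finPOrderType d) n
    (e : 'I_n -> R) : 'M[K]_n :=
  - ((cartan_mx K e)^T *m invmx (cartan_mx K e)).

(* is_trig_mx means lower triangular *)
Definition upper_triangular (K : pzRingType) n (A : 'M[K]_n) : bool :=
  is_trig_mx A^T.

(* This is the column convention: s i is the row of the nonzero entry of column
   i. The permutation matrix corresponding to s is perm_mx s^-1, not perm_mx s. *)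
Definition perm_of_mx (K : pzRingType) n (P : 'M[K]_n) (s : 'S_n) : Prop :=
  forall i j : 'I_n, (P j i != 0) = (j == s i).

Definition coxeter_permutation (K : pzRingType) n (C : 'M[K]_n) (s : 'S_n) :
    Prop :=
  exists U1 P U2 : 'M[K]_n,
    [/\ upper_triangular U1, is_perm_mx P, upper_triangular U2,
        C = U1 *m P *m U2 & perm_of_mx P s].

End Coxeter.

(* Main.v *)
Require Import Defs.
From mathcomp Require Import all_boot all_order all_fingroup all_algebra.

(** Write [z = row x]. Since [z] is generated by minimal elements of the
    complement of [x], [z <= t `|` x] forces [z <= t]. The row of the Coxeter
    matrix [C] indexed by [z] is the function [F] with
    [\sum_(y >= t) F y = - [z <= t]] for all [t]. Comparing this equation at [t]
    and at [t `|` x], descending induction on [t] gives [F t = 0] unless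
    [x <= t]. Hence permuting the rows of [C] by rowmotion yields an upper
    triangular matrix. Uniqueness is the uniqueness part of the Bruhat
    decomposition of the invertible matrix [C]. *)

Set Implicit Arguments.
Unset Strict Implicit.
Unset Printing Implicit Defensive.

Import Order.TTheory GRing.Theory.

Local Open Scope ring_scope.

Lemma minimals_below d (Q : finPOrderType d) (A : {set Q}) (q : Q) :
  q \in A -> exists2 m, m \in minimals A & (m <= q)%O.
Proof.
move=> qA; pose P m := (m \in A) && (m <= q)%O.
have Pq : P q by rewrite /P qA lexx.
(* A strictly smaller element has a strictly smaller principal ideal, so minimizing the cardinality
   of that ideal yields a minimal element. *)
case: (arg_minnP (fun m => #|[set z : Q | (z <= m)%O]|) Pq).
move=> m /andP[mA mq] min_m; exists m => //.
rewrite inE mA; apply/forall_inP => y yA; apply/negP => ym.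
have := min_m y; rewrite /P yA (le_trans (ltW ym) mq) => /(_ isT).
rewrite leqNgt => /negP; apply; apply: proper_card; apply/properP; split.
  by apply/subsetP => z; rewrite !inE => /le_trans; apply; apply: ltW.
by exists m; rewrite inE ?lexx // lt_geF.
Qed.

Section RowmotionTheory.
Variables (d : Order.disp_t) (R : finTBDistrLatticeType d).
Implicit Types (x y t : R) (q : JI R).

(** By distributivity, [q] below the join equals the join of its meets with [x] and [y];
    irreducibility makes it one of the two. *)
Lemma mem_birkhoffU q x y :
  (q \in birkhoff (x `|` y)%O) = (q \in birkhoff x) || (q \in birkhoff y).
Proof.
rewrite !inE; apply/idP/orP => [qxy|[] qz]; last 2 first.
- by rewrite (le_trans qz) ?leUl.
- by rewrite (le_trans qz) ?leUr.
have /andP[_ /forallP/(_ (val q `&` x)%O)/forallP/(_ (val q `&` y)%O)] := valP q.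
rewrite -meetUr; move/meet_idPl: (qxy) => ->; rewrite eqxx /=.
by case/orP => /eqP ->; [left|right]; rewrite leIr.
Qed.

(** The generators of the ideal of [rowmotion x] lie outside that of [x]; being join-prime, once
    below the join they lie below [t]. *)
Lemma rowmotion_leU x t : (rowmotion x <= t `|` x)%O = (rowmotion x <= t)%O.
Proof.
apply/idP/idP => [|/le_trans]; last by apply; rewrite leUl.
rewrite -!birkhoff_le birkhoff_rowmotion => /subsetP sub.
apply/subsetP => q; rewrite inE => /existsP[m /andP[min_m qm]].
have m_row : m \in row_ideal (birkhoff x).
  by rewrite inE; apply/existsP; exists m; rewrite min_m lexx.
have := min_m; rewrite inE in_setC => /andP[/negPf mx _].
have := sub m m_row; rewrite mem_birkhoffU mx orbF !inE.
by apply: le_trans; rewrite Order.le_val.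
Qed.

(** If [q] lies in [x] but not in [y], some [m] minimal outside [y] is below [q], hence in [x]. The
    equal rows give [m <= p <= r] with [p] minimal outside [x] and [r] minimal outside [y]. Since
    [p] differs from [m], this contradicts the minimality of [r]. *)
Lemma rowmotion_inj : injective (@rowmotion d R).
Proof.
suff le_of_eq x y : rowmotion x = rowmotion y -> (x <= y)%O.
  by move=> x y E; apply/le_anti; rewrite !le_of_eq.
move=> /(congr1 (@birkhoff d R)); rewrite !birkhoff_rowmotion => E.
rewrite -birkhoff_le; apply/subsetP => q qx; apply: contraT => qy.
have [|m min_m mq] := @minimals_below _ _ (~: birkhoff y) q.
  by rewrite in_setC.
have mx : m \in birkhoff x.
  by move: qx; rewrite !inE; apply: le_trans; rewrite Order.le_val.
have : m \in row_ideal (birkhoff x).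
  by rewrite E inE; apply/existsP; exists m; rewrite min_m lexx.
rewrite inE => /existsP[p /andP[min_p mp]].
have : p \in row_ideal (birkhoff y).
  by rewrite -E inE; apply/existsP; exists p; rewrite min_p lexx.
rewrite inE => /existsP[r /andP[min_r pr]].
have px : p \notin birkhoff x.
  by move: min_p; rewrite inE in_setC => /andP[].
have my : m \in ~: birkhoff y by move: min_m; rewrite inE => /andP[].
have lt_mr : (m < r)%O.
  apply: lt_le_trans pr; rewrite lt_def mp andbT.
  by apply: contraNneq px => ->.
by move: min_r; rewrite inE => /andP[_ /forall_inP/(_ m my)]; rewrite lt_mr.
Qed.

End RowmotionTheory.

Section UpperTriangular.

Lemma upper_triangularP (K : pzRingType) n (A : 'M[K]_n) :
  reflect (forall i j : 'I_n, (j < i)%N -> A i j = 0) (upper_triangular A).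
Proof.
apply: (iffP is_trig_mxP) => upA i j ij; first by have := upA j i ij; rewrite mxE.
by rewrite mxE upA.
Qed.

Lemma upper_triangular1 (K : pzRingType) n : upper_triangular (1%:M : 'M[K]_n).
Proof. by rewrite /upper_triangular trmx1 scalar_mx_is_trig. Qed.

Variables (K : idomainType) (n : nat).
Implicit Types A B C U V P Q : 'M[K]_n.

Lemma upper_triangular_diag_neq0 A (i : 'I_n) :
  upper_triangular A -> A \in unitmx -> A i i != 0.
Proof.
move=> upA; rewrite unitmxE -det_tr det_trig // (bigD1 i) //= mxE unitrM.
by move=> /andP[uAii _]; apply: contraTneq uAii => ->; rewrite unitr0.
Qed.

(** Below the diagonal, the [(i, j)] entry of the product reduces to [A i j * B j j]: terms [k < j]
    vanish by induction on the column, terms [k > j] by triangularity of [B]. *)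
Lemma upper_triangular_divr A B :
  B \in unitmx -> upper_triangular B -> upper_triangular (A *m B) ->
  upper_triangular A.
Proof.
move=> unitB upB /upper_triangularP upAB; apply/upper_triangularP => i j.
have [m] := ubnP j; elim: m j => // m IHm j ltjm ltji.
have := upAB i j ltji; rewrite mxE (bigD1 j) //= big1 => [|k kj].
  move/eqP; rewrite addr0 mulf_eq0 (negPf (upper_triangular_diag_neq0 _ _ _)) //.
  by rewrite orbF => /eqP.
case: (ltngtP k j) => [ltkj|ltjk|/val_inj E]; last by rewrite E eqxx in kj.
  by rewrite IHm ?mul0r // ?(leq_trans ltkj ltjm) // (ltn_trans ltkj).
by move/upper_triangularP: upB => ->; rewrite ?mulr0.
Qed.

Lemma upper_triangular_inv A :
  A \in unitmx -> upper_triangular A -> upper_triangular (invmx A).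
Proof.
move=> uA upA; apply: (upper_triangular_divr uA upA).
by rewrite mulVmx // upper_triangular1.
Qed.

Lemma upper_triangular_mul A B :
  B \in unitmx -> upper_triangular A -> upper_triangular B ->
  upper_triangular (A *m B).
Proof.
move=> uB upA upB; apply: (@upper_triangular_divr _ (invmx B)).
- by rewrite unitmx_inv.
- exact: upper_triangular_inv.
- by rewrite mulmxK.
Qed.

Lemma perm_of_mxE P (s : 'S_n) :
  is_perm_mx P -> perm_of_mx P s -> P = perm_mx s^-1.
Proof.
move=> /is_perm_mxP[t ->] ts; congr perm_mx; apply/permP => j.
have := ts (s^-1 j)%g j; rewrite permKV eqxx !mxE.
by case: (t j =P _) => // _; rewrite eqxx.
Qed.

Lemma perm_of_perm_mx (s : 'S_n) : perm_of_mx (perm_mx s^-1 : 'M[K]_n) s.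
Proof.
move=> i j; rewrite !mxE -(inj_eq (@perm_inj _ s)) permKV.
by case: (j =P _); rewrite ?oner_eq0 ?eqxx.
Qed.

(** Both permutations have the same sum of values, so no inequality can be strict. *)
Lemma perm_leq_eq (s t : 'S_n) : (forall i, s i <= t i)%N -> s = t.
Proof.
move=> le_st; apply/permP => i; apply/val_inj/eqP => /=.
have /leqif_sum[_] : forall j, true -> (s j <= t j ?= iff (s j == t j :> nat))%N.
  by move=> j _; split.
rewrite -(reindex_inj (@perm_inj _ s) (P := predT) (F := val)) /=.
rewrite -(reindex_inj (@perm_inj _ t) (P := predT) (F := val)) /= eqxx.
by move=> /esym/forallP; apply.
Qed.

Lemma coxeter_permutation_inj C (s t : 'S_n) :
  C \in unitmx -> coxeter_permutation C s -> coxeter_permutation C t -> s = t.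
Proof.
suff le C' (s' t' : 'S_n) : C' \in unitmx -> coxeter_permutation C' s' ->
    coxeter_permutation C' t' -> forall i, (t' i <= s' i)%N.
  by move=> uC Cs Ct; apply: perm_leq_eq => i; exact: (le C).
move=> {C s t}; move: C' s' t' => C s t uC.
move=> [U1 [P [U2 [upU1 permP upU2 CE /(perm_of_mxE permP) PE]]]].
move=> [V1 [Q [V2 [upV1 permQ upV2 CE' /(perm_of_mxE permQ) QE]]]] i.
have [uU1 uU2] : U1 \in unitmx /\ U2 \in unitmx.
  by move: uC; rewrite CE !unitmx_mul => /andP[/andP[]].
have [uV1 uV2] : V1 \in unitmx /\ V2 \in unitmx.
  by move: uC; rewrite CE' !unitmx_mul => /andP[/andP[]].
pose W := invmx V1 *m U1; pose X := V2 *m invmx U2.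
have upW : upper_triangular W.
  by apply: upper_triangular_mul => //; apply: upper_triangular_inv.
have upX : upper_triangular X.
  by apply: upper_triangular_mul; rewrite ?unitmx_inv ?upper_triangular_inv.
have uX : X \in unitmx by rewrite unitmx_mul uV2 unitmx_inv.
(* The [(t i, i)] entry of this matrix is the nonzero diagonal entry [X i i] on the right and
   [W (t i) (s i)] on the left; the latter vanishes if [s i < t i]. *)
have WPQX : W *m P = Q *m X.
  apply: (can_inj (mulKmx uV1)); apply: (can_inj (mulmxK uU2)).
  by rewrite /W /X !mulmxA mulmxV // mul1mx mulmxKV // -CE -CE'.
have := upper_triangular_diag_neq0 i upX uX; rewrite leqNgt.
apply: contraNN => lt_st.
have <- : (Q *m X) (t i) i = X i i by rewrite QE -row_permE mxE permK.
rewrite -WPQX PE -col_permE mxE.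
by move/upper_triangularP: upW => ->.
Qed.

End UpperTriangular.

Section CoxeterMatrix.
Variables (K : idomainType) (d : Order.disp_t).

(** Along a linear extension the matrix is lower triangular with ones on the diagonal. *)
Lemma cartan_mx_unit (R : finPOrderType d) n (e : 'I_n -> R) :
  linear_extension e -> cartan_mx K e \in unitmx.
Proof.
move=> [/bij_inj e_inj e_lt]; rewrite unitmxE det_trig.
  by rewrite big1 ?unitr1 // => i _; rewrite mxE lexx.
apply/is_trig_mxP => i j ltij; rewrite mxE le_eqVlt (inj_eq e_inj).
case: eqP ltij => [->|_ ltij /=]; first by rewrite ltnn.
by case: (boolP (e j < e i)%O) => // /e_lt /(ltn_trans ltij); rewrite ltnn.
Qed.

Lemma coxeter_mx_unit (R : finPOrderType d) n (e : 'I_n -> R) :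
  linear_extension e -> coxeter_mx K e \in unitmx.
Proof.
move=> /cartan_mx_unit u; rewrite /coxeter_mx -scaleN1r unitmxZ ?unitrN1 //.
by rewrite unitmx_mul unitmx_tr unitmx_inv u.
Qed.

Lemma coxeter_mx_row_sum (R : finPOrderType d) n (e : 'I_n -> R) (i j : 'I_n) :
  linear_extension e ->
  \sum_k coxeter_mx K e i k * (e j <= e k)%O%:R = - (e i <= e j)%O%:R.
Proof.
move=> /cartan_mx_unit u.
have : coxeter_mx K e *m cartan_mx K e = - (cartan_mx K e)^T.
  by rewrite /coxeter_mx mulNmx mulmxKV.
move=> /matrixP/(_ i j); rewrite !mxE => <-.
by apply: eq_bigr => k _; rewrite [cartan_mx _ _ _ _]mxE.
Qed.

Variables (R : finTBDistrLatticeType d) (n : nat) (e : 'I_n -> R).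
Hypothesis he : linear_extension e.

Lemma coxeter_mx_rowmotion_eq0 (i j k : 'I_n) :
  e k = rowmotion (e i) -> ~~ (e i <= e j)%O -> coxeter_mx K e k j = 0.
Proof.
move=> ek; have [[g eK gK] e_lt] := he.
(* Descending induction on the position [j] in the linear extension. *)
have [m] := ubnP (n - j); elim: m j => // m IHm j ltm nij.
pose l := g (e j `|` e i)%O; have el : e l = (e j `|` e i)%O by rewrite /l gK.
have : \sum_h coxeter_mx K e k h * ((e j <= e h)%O%:R - (e l <= e h)%O%:R) = 0.
  under eq_bigr do rewrite mulrBr.
  by rewrite sumrB !coxeter_mx_row_sum // el ek rowmotion_leU subrr.
(* The coefficient of index [h] is nonzero only when [e h] is above [e j] but not above [e i]. It is
   1 at [h = j]; any other such [h] comes later and is covered by induction. *)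
rewrite (bigD1 j) //= big1 => [|h hj].
  by rewrite el leUx (negPf nij) andbF lexx subr0 mulr1 addr0.
rewrite el leUx; have [jh|_] := boolP (e j <= e h)%O; last by rewrite subrr mulr0.
have [ih|nih] := boolP (e i <= e h)%O; first by rewrite subrr mulr0.
have ltjh : (j < h)%N by apply: e_lt; rewrite lt_def jh (can_eq eK) hj.
by rewrite IHm ?mul0r // (leq_trans _ (ltm : (n - j <= m)%N)) // ltn_sub2l.
Qed.

End CoxeterMatrix.

Theorem theorem4p9 (K : idomainType) (d : Order.disp_t)
    (R : finTBDistrLatticeType d) (n : nat) (e : 'I_n -> R)
    (he : linear_extension e) :
  exists (P U : 'M[K]_n) (s : 'S_n),
    [/\ is_perm_mx P, upper_triangular U & coxeter_mx K e = P *m U] /\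
    [/\ perm_of_mx P s,
        unique (coxeter_permutation (coxeter_mx K e)) s &
        forall i : 'I_n, e (s i) = rowmotion (e i)].
Proof.
have [[g eK gK] e_lt] := he.
have s_inj : injective (fun i => g (rowmotion (e i))).
  by apply: inj_comp (can_inj gK) (inj_comp (@rowmotion_inj _ R) (can_inj eK)).
pose s : 'S_n := perm s_inj.
have es i : e (s i) = rowmotion (e i) by rewrite permE gK.
pose P : 'M[K]_n := perm_mx s^-1; pose U := row_perm s (coxeter_mx K e).
(* Row [i] of [U] is the row of [C] indexed by [rowmotion (e i)], supported on elements above [e i],
   which do not precede [e i] in the extension. *)
have upU : upper_triangular U.
  apply/upper_triangularP => i j ltji; rewrite mxE.
  apply: (coxeter_mx_rowmotion_eq0 K he (es i)); apply/negP.
  rewrite le_eqVlt (can_eq eK) => /orP[/eqP E|/e_lt].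
    by rewrite E ltnn in ltji.
  by move/(ltn_trans ltji); rewrite ltnn.
have CE : coxeter_mx K e = P *m U.
  by rewrite /P /U row_permE mulmxA -perm_mxM mulVg perm_mx1 mul1mx.
have permP : is_perm_mx P by apply: perm_mx_is_perm.
have Ps : perm_of_mx P s := perm_of_perm_mx K s.
have Cs : coxeter_permutation (coxeter_mx K e) s.
  by exists 1%:M, P, U; split=> //; rewrite ?upper_triangular1 // mul1mx.
exists P, U, s; split; split=> //; split=> // t.
exact: coxeter_permutation_inj (coxeter_mx_unit K he) Cs.
Qed.
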